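(* For every uncountable cardinal $\kappa$, there exists a coloring $c:[\kappa]^2\to\omega$ such that $c''(A\otimes B)=\omega$ for any $A,B\subseteq\kappa$ of order type $\omega_1$ with $\sup A=\sup B$ such that both $A$ and $B$ are stationary in their common supremum.
   Context: $[\kappa]^2$ is the set of two-element subsets of $\kappa$, identified with pairs $(\alpha,\beta)$ with $\alpha<\beta<\kappa$. For sets of ordinals $A,B$, $A\otimes B=\{(\alpha,\beta):\alpha<\beta,\ \alpha\in A,\ \beta\in B\}$, and $c''(A\otimes B)=\{c(\alpha,\beta):(\alpha,\beta)\in A\otimes B\}$. A set $A$ of ordinals is stationary in a limit ordinal $\delta$ of uncountable cofinality if $A\cap\delta$ meets every closed unbounded subset of $\delta$. (If $A$ has order type $\omega_1$, then $\sup A$ has cofinality $\omega_1$.) *)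

(* Defs.v *)
From mathcomp Require Import all_boot all_order.
From mathcomp Require Import all_classical wochoice.

Set Implicit Arguments.
Unset Strict Implicit.
Unset Printing Implicit Defensive.

Local Open Scope classical_set_scope.
Local Open Scope card_scope.
Local Open Scope order_scope.

(* Ordinals are represented by well-ordered types.  An element x of such a type
   K stands for the ordinal coded by the initial segment [set y | y < x]. *)
Definition is_ordinal d (K : orderType d) : Prop :=
  well_order (<=%O : rel K).

(* Cardinals are initial ordinals: no smaller ordinal has the same size. *)
Definition is_cardinal d (K : orderType d) : Prop :=
  is_ordinal K /\ forall x : K, ~ ([set: K] #<= [set y : K | y < x]).

Definition is_uncountable_cardinal d (K : orderType d) : Prop :=
  is_cardinal K /\ ~ countable [set: K].

(* omega_1 is the least uncountable ordinal; the ordinals below W are its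
   proper initial segments. *)
Definition is_omega1 d (W : orderType d) : Prop :=
  [/\ is_ordinal W, ~ countable [set: W]
    & forall x : W, countable [set y : W | y < x]].

Definition has_order_type d (K : orderType d) (A : set K)
    d' (W : orderType d') : Prop :=
  exists f : W -> K, {mono f : x y / x <= y} /\ range f = A.

Definition has_order_type_omega1 d (K : orderType d) (A : set K) : Prop :=
  exists (d' : Order.disp_t) (W : orderType d'),
    is_omega1 W /\ has_order_type A W.

(* The supremum of a set of ordinals is its union.  It is kept as an initial
   segment of K because it need not be an element of K: it may be K itself. *)
Definition ord_sup d (K : orderType d) (A : set K) : set K :=
  \bigcup_(a in A) [set y : K | y < a].

(* Closed unbounded subsets of an initial segment delta: closed means that C
   contains every limit point of C below delta. *)
Definition unbounded_in d (K : orderType d) (C delta : set K) : Prop :=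
  forall x, delta x -> exists y, [/\ C y, delta y & x <= y].

Definition limit_point d (K : orderType d) (C : set K) (g : K) : Prop :=
  (exists x, x < g) /\ forall x, x < g -> exists y, [/\ C y, x < y & y < g].

Definition closed_in d (K : orderType d) (C delta : set K) : Prop :=
  forall g, delta g -> limit_point C g -> C g.

Definition is_club d (K : orderType d) (C delta : set K) : Prop :=
  [/\ C `<=` delta, unbounded_in C delta & closed_in C delta].

(* Only meant for delta a limit ordinal of uncountable cofinality. *)
Definition stationary_in d (K : orderType d) (A delta : set K) : Prop :=
  forall C, is_club C delta -> ((A `&` delta) `&` C) !=set0.

(* Two-element subsets of K, listed in increasing order. *)
Definition pairs d (K : orderType d) : Type := {p : K * K | p.1 < p.2}.

Definition tensor d (K : orderType d) (A B : set K) : set (pairs K) :=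
  [set p | A (sval p).1 /\ B (sval p).2].

(* Main.v *)
(** Give every [b] of countable cofinality a ladder converging to it, and let
    [r b x] be the number of its points below [x].  The color of [(a, b)] only
    depends on the number of [v < r b a] such that [r a] is not constant on
    [{x < a | r b x = v}], i.e. on how often the ladder of [b] below [a]
    alternates with the ladder of [a].  Let [delta] be the common supremum.  A
    ladder has no accumulation point below its limit, so for every stationary
    [S] there is [e < delta] such that for all [z < delta] stationarily many
    members of [S] have no ladder point between [e] and [z]; by pressing down,
    stationarily many of them do have one between [e] and some fixed
    [e' < delta].  Using this in turn on [A] and [B], with
    the ladders of the other set kept constant meanwhile, any number [k] of
    alternations can be produced on top of an uncontrolled initial part of at
    most [N] alternations, where [N] does not depend on [k].  A map from nat to
    nat taking each value on arbitrarily long intervals absorbs this error. *)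

Require Import Defs.
From mathcomp Require Import all_boot all_order.
From mathcomp Require Import all_classical.
From mathcomp Require Import zify.

Set Implicit Arguments.
Unset Strict Implicit.
Unset Printing Implicit Defensive.

Import Order.TTheory.
Local Open Scope order_scope.
Local Open Scope classical_set_scope.

(** * Clubs and stationary sets in a segment of uncountable cofinality *)

Lemma ordinal_min d (K : orderType d) (P : K -> Prop) :
  is_ordinal K -> (exists x, P x) ->
  exists x, P x /\ forall y, P y -> x <= y.
Proof.
move=> wo [x0 Px0].
have [|x [[Px lx] _]] := wo [pred x | `[< P x >]].
  by exists x0; apply/asboolP.
exists x; split; first exact/asboolP.
by move=> y Py; apply: lx; apply/asboolP.
Qed.

(** [delta] is a set of points since it may be all of [K]. The case of empty [X] makes it
    nonempty. *)
Definition uncountable_cofinality d (K : orderType d) (delta : set K) : Prop :=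
  (forall x y, delta x -> y < x -> delta y) /\
  (forall X : set K, countable X -> X `<=` delta ->
    exists2 y, delta y & forall x, X x -> x < y).

Section StationarySets.
Context {d : Order.disp_t} {K : orderType d}.
Hypothesis woK : is_ordinal K.
Variable delta : set K.
Hypothesis cof_delta : uncountable_cofinality delta.

Let stat (S : set K) := stationary_in S delta.

Lemma seq_sup (x : nat -> K) :
  (forall n, delta (x n)) ->
  exists g, [/\ delta g, forall n, x n < g & forall y, y < g -> exists n, y <= x n].
Proof.
move=> dx; have [down bnd] := cof_delta.
have [||z dz xz] := bnd (range x).
- exact: sub_countable (card_image_le _ _) (countableP _).
- by move=> _ [n _ <-].
have [|g [xg gmin]] := ordinal_min (P := fun g => forall n, x n < g) woK.
  by exists z => n; apply: xz; exists n.
exists g; split => //.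
  have : g <= z by apply: gmin => n; apply: xz; exists n.
  by rewrite le_eqVlt => /orP[/eqP->//|]; exact: down.
move=> y yg; apply: contrapT => no.
have /gmin : forall n, x n < y.
  by move=> n; rewrite ltNge; apply/negP => yx; apply: no; exists n.
by rewrite leNgt yg.
Qed.

Lemma bound1 x : delta x -> exists2 y, delta y & x < y.
Proof.
move=> dx; have [_ bnd] := cof_delta.
have [||y dy xy] := bnd [set x]; first exact: countable1.
  by move=> _ ->.
by exists y => //; apply: xy.
Qed.

(* The instance [act x = A `&` [set a | a < x]] is the diagonal intersection of
   clubs indexed by [A], and [act x = setT] the countable intersection. *)
Lemma diagonal_club (I : Type) (act : K -> set I) (D : I -> set K) :
  (forall x, delta x -> countable (act x)) ->
  (forall x y, x <= y -> act x `<=` act y) ->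
  (forall g i, (exists x, x < g) ->
     (forall x, x < g -> exists2 y, x < y & y < g) ->
     act g i -> exists2 x, x < g & act x i) ->
  (forall i, is_club (D i) delta) ->
  is_club [set x | delta x /\ forall i, act x i -> D i x] delta.
Proof.
move=> cact mact lact clubD; have [down bnd] := cof_delta.
split; first by move=> x [].
- move=> x0 dx0.
  (* One step of closing off: [y] lies above a point of [D i] past [x] for every [i] active at [x].
     These are countably many, so [y] can be found in [delta]. *)
  have nextP x : exists y, delta x -> [/\ delta y, x < y &
      forall i, act x i -> exists z, [/\ D i z, x < z & z < y]].
    have [dx|ndx] := pselect (delta x); last by exists x => /ndx.
    have [x' dx' xx'] := bound1 dx.
    have /choice[h hP] i : exists z, [/\ D i z, delta z & x' <= z].
      by have [_ /(_ _ dx')] := clubD i.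
    have [||y dy hy] := bnd (h @` act x).
    + exact: sub_countable (card_image_le _ _) (cact _ dx).
    + by move=> _ [i _ <-]; have [] := hP i.
    exists (Order.max x' y) => _; split; first by rewrite /Order.max; case: ifP.
      by rewrite lt_max xx'.
    move=> i ai; exists (h i); have [Dh _ x'h] := hP i.
    by split=> //; [exact: lt_le_trans x'h | rewrite lt_max (hy (h i)) ?orbT//; exists i].
  have [f fP] := choice nextP.
  pose x n := iter n f x0.
  have dx n : delta (x n) by elim: n => //= n /fP[].
  have xS n : x n < x n.+1 by have [] := fP _ (dx n).
  have [g [dg xg gx]] := seq_sup dx.
  exists g; split=> //; last exact: ltW (xg 0%N).
  split=> // i ai.
  have [y yg ay] : exists2 y, y < g & act y i.
    apply: lact ai; first by exists x0; exact: (xg 0%N).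
    move=> y /gx[n yn]; exists (x n.+1) => //.
    exact: le_lt_trans (xS n).
  have [n yn] := gx _ yg.
  have [_ _ closedD] := clubD i; apply: closedD => //; split.
    by exists x0; exact: (xg 0%N).
  move=> z zg; have [m zm] := gx _ zg.
  have xmono : {homo x : a b / (a <= b)%N >-> a <= b}.
    by apply: homo_leq => //[|k]; [exact: le_trans | exact: ltW].
  have [_ _ /(_ i) []] := fP _ (dx (maxn n m)).
    by apply: (mact _ _ _ _ ay); apply: le_trans yn (xmono _ _ _); exact: leq_maxl.
  move=> w [Dw xw wx]; exists w; split => //.
    by apply: le_lt_trans xw; apply: le_trans zm (xmono _ _ _); exact: leq_maxr.
  exact: lt_trans wx (xg (maxn n m).+1).
- move=> g dg [g0 gl]; split=> // i ai.
  have [y yg ay] : exists2 y, y < g & act y i.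
    apply: lact ai => // x /gl[y [_ xy yg]]; by exists y.
  have [_ _ closedD] := clubD i; apply: closedD => //; split=> // z zg.
  have [|w [[dw Dw] zw wg]] := gl (Order.max y z); first by rewrite gt_max yg.
  exists w; move: zw; rewrite gt_max => /andP[yw zw]; split=> //.
  by apply: Dw; apply: (mact y) => //; exact: ltW.
Qed.

Lemma stationary_sub (S S' : set K) : S `<=` S' -> stat S -> stat S'.
Proof. by move=> sub statS C /statS[x [[/sub ? ?] ?]]; exists x. Qed.

Lemma not_stationary (S : set K) :
  ~ stat S -> exists2 D, is_club D delta & forall x, S x -> D x -> False.
Proof.
move=> /existsNP[C /not_implyP[clubC disj]]; exists C => // x Sx Cx.
by apply: disj; exists x; split=> //; split=> //; have [/(_ _ Cx)] := clubC.
Qed.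

(** If each piece missed a club, the intersection of these countably many clubs would miss [S]. *)
Lemma stationary_bigcup (S : set K) (Phi : nat -> set K) :
  stat S -> (forall x, S x -> exists n, Phi n x) ->
  exists n, stat (S `&` Phi n).
Proof.
move=> statS cover; apply: contrapT => no.
have /choice[D DP] n : exists D, is_club D delta /\
    forall x, (S `&` Phi n) x -> D x -> False.
  have [|D ? ?] := @not_stationary (S `&` Phi n); last by exists D.
  by move=> st; apply: no; exists n.
have [] := statS _ (@diagonal_club nat (fun _ => setT) D _ _ _ _) => //.
- by move=> g i [x xg] _ _; exists x.
- by move=> n; have [] := DP n.
move=> x [[Sx _] [_ Dx]]; have [n Pn] := cover _ Sx.
by have [_ /(_ x)] := DP n; apply; [split | exact: Dx].
Qed.

(** Of the two pieces into which [C] cuts [S], the one outside [C] misses a club. *)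
Lemma stationary_club (S C : set K) :
  stat S -> is_club C delta -> stat (S `&` C).
Proof.
move=> statS clubC.
have [||n] := @stationary_bigcup S (fun n => if n == 0%N then C else ~` C) => //.
  by move=> x _; have [Cx|nCx] := pselect (C x); [exists 0%N | exists 1%N].
case: n => [|n] /=; first exact.
by move=> /(_ _ clubC)[x [[[_ nC] _] /nC]].
Qed.

Lemma stationary_tail (S : set K) x :
  stat S -> delta x -> stat (S `&` [set y | x < y]).
Proof.
move=> statS dx; apply: stationary_sub (_ : S `&` [set y | delta y /\ x < y] `<=` _) _.
  by move=> y [? []].
apply: stationary_club => //; split; first by move=> y [].
- move=> y dy; have [z dz xz] := bound1 dx; have [w dw yw] := bound1 dy.
  have dm : delta (Order.max z w) by rewrite /Order.max; case: ifP.
  exists (Order.max z w); split=> //; last by rewrite le_max (ltW yw) orbT.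
  by split=> //; rewrite lt_max xz.
- by move=> g dg [[y yg] gl]; split=> //; have [z [[_ xz] _ zg]] := gl _ yg; exact: lt_trans zg.
Qed.

Lemma stationary_gt (S : set K) x :
  stat S -> delta x -> exists2 y, S y & x < y.
Proof.
move=> statS dx; have [|y [[[Sy xy] _] _]] := stationary_tail statS dx (C := delta).
- by split=> // y dy; exists y.
- by exists y.
Qed.

(** * Pressing down and ladder ranks *)

Section Ladders.
Variables (A : set K) (r : K -> K -> nat).
Hypothesis sub_A : A `<=` delta.
Hypothesis cofinal_A : forall x, delta x -> exists2 a, A a & x < a.
Hypothesis countable_A : forall x, delta x -> countable (A `&` [set a | a < x]).

Definition limits : set K := [set g | delta g /\ limit_point A g].

Lemma limits_club : is_club limits delta.
Proof.
split; first by move=> x [].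
- move=> x0 dx0.
  have /choice[f fP] x : exists y, delta x -> A y /\ x < y.
    have [dx|ndx] := pselect (delta x); last by exists x => /ndx.
    by have [a] := cofinal_A dx; exists a.
  pose x n := iter n f x0.
  have dx n : delta (x n) by elim: n => //= n /fP[/sub_A].
  have [g [dg xg gx]] := seq_sup dx.
  exists g; split=> //; last exact: ltW (xg 0%N).
  split=> //; split; first by exists x0; exact: (xg 0%N).
  move=> y /gx[n yn]; have [Ax xS] := fP _ (dx n).
  by exists (x n.+1); split => //; exact: le_lt_trans xS.
- move=> g dg [[y0 y0g] gl]; split=> //; split; first by exists y0.
  move=> y /gl[z [[_ [_ zl]] yz zg]]; have [w [Aw yw wz]] := zl _ yz.
  by exists w; split=> //; exact: lt_trans zg.
Qed.

(* [rho] need not be constant on a stationary set: initial segments of [delta]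
   may be uncountable. *)
Lemma fodor (S : set K) (rho : K -> K) :
  stat S -> S `<=` limits -> (forall x, S x -> rho x < x) ->
  exists2 e, delta e & stat (S `&` [set x | rho x <= e]).
Proof.
move=> statS SL rhoS; apply: contrapT => no.
have /choice[D DP] a : exists D, is_club D delta /\
    (A a -> forall x, (S `&` [set x | rho x <= a]) x -> D x -> False).
  have [Aa|nAa] := pselect (A a); last by exists limits; split=> //; exact: limits_club.
  have [|D ? ?] := @not_stationary (S `&` [set x | rho x <= a]); last by exists D.
  by move=> st; apply: no; exists a => //; exact: sub_A.
have [] := statS _ (@diagonal_club K (fun x => A `&` [set a | a < x]) D _ _ _ _) => //.
- by move=> x y xy a [? /= ax]; split=> //=; exact: lt_le_trans xy.
- by move=> g a _ gl [Aa /= /gl[y ay yg]]; exists y.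
- by move=> a; have [] := DP a.
(* As [x] is a limit of [A], some [a < x] in [A] lies above [rho x], although [D a] contains [x]. *)
move=> x [[Sx dx] [_ Dx]]; have [_ [_ xl]] := SL _ Sx.
have [a [Aa ra ax]] := xl _ (rhoS _ Sx).
by have [_ /(_ Aa x)] := DP a; apply; [split=> //; exact: ltW | exact: Dx].
Qed.

(* [r x y] plays the role of the number of points below [y] of a ladder of
   order type omega converging to [x]. *)
Definition is_rank (rho : K -> nat) (x : K) : Prop :=
  (forall y z, y <= z -> z < x -> (rho y <= rho z)%N) /\
  (forall n, exists2 y, y < x & (n < rho y)%N).

Hypothesis rank_r : forall x, limits x -> is_rank (r x) x.

(** The stationary set may depend on [z]. The case [z = e] says that [S] itself is stationary. *)
Definition constant_beyond (S : set K) (e : K) : Prop :=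
  forall z, delta z -> e <= z -> stat (S `&` [set x | r x e = r x z]).

(* Otherwise a sequence [e n] can be built such that, for stationary many [x],
   the rank [r x] increases between any two of its terms, and hence is
   infinite at its supremum. *)
Lemma exists_constant_beyond (S : set K) e0 :
  stat S -> S `<=` limits -> delta e0 ->
  exists e, [/\ delta e, e0 <= e & constant_beyond S e].
Proof.
move=> statS SL de0; apply: contrapT => no.
have /choice[f fP] e : exists z, delta e -> e0 <= e ->
    [/\ delta z, e <= z & ~ stat (S `&` [set x | r x e = r x z])].
  have [de|nde] := pselect (delta e); last by exists e => /nde.
  have [le|nle] := pselect (e0 <= e); last by exists e => _ /nle.
  apply: contrapT => no'; apply: no; exists e; split=> // z dz ez.
  by apply: contrapT => nst; apply: no'; exists z.
pose x n := iter n f e0.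
have xP n : delta (x n) /\ e0 <= x n.
  elim: n => //= n [dx le]; have [? le' _] := fP _ dx le.
  by split=> //; exact: le_trans le'.
have [|g [dg xg _]] := @seq_sup x; first by move=> n; case: (xP n).
have [|n st] := stationary_bigcup
    (Phi := fun n => [set y | r y (x n) = r y (x n.+1)]) (stationary_tail statS dg).
  move=> y [Sy gy]; apply: contrapT => noy.
  have [mono _] := rank_r (SL _ Sy).
  have big n : (n <= r y (x n))%N.
    elim: n => // n IH; apply: leq_ltn_trans IH _.
    rewrite ltn_neqAle; apply/andP; split; first by apply/eqP => E; apply: noy; exists n.
    have [? ?] := xP n; apply: mono; first by have [] := fP (x n).
    exact: lt_trans (xg n.+1) gy.
  have le := mono (x (r y g).+1) g (ltW (xg _)) gy.
  by have := leq_trans (big _) le; rewrite ltnn.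
have [dx le] := xP n; have [_ _] := fP _ dx le; apply.
by apply: stationary_sub st => y [[]].
Qed.

(** Each [x] in [S] has some [y < x] of rank above [r x e]. Pressing down bounds these [y] by a
    single point on a stationary set. *)
Lemma stationary_jump (S : set K) e :
  stat S -> S `<=` limits -> delta e ->
  exists e', [/\ delta e', e < e' &
    stat (S `&` [set x | e' < x /\ (r x e < r x e')%N])].
Proof.
move=> statS SL de.
have /choice[rho rhoP] x : exists y, S x -> y < x /\ (r x e < r x y)%N.
  have [Sx|nSx] := pselect (S x); last by exists x => /nSx.
  have [_ /(_ (r x e))[y]] := rank_r (SL _ Sx); by exists y.
have [|e1 de1 st] := fodor statS SL (rho := rho); first by move=> x /rhoP[].
have [e2 de2 ee2] := bound1 de.
have dm : delta (Order.max e1 e2) by rewrite /Order.max; case: ifP.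
exists (Order.max e1 e2); split=> //; first by rewrite lt_max ee2 orbT.
apply: stationary_sub (stationary_tail st dm) => x [[Sx /= le1] ltx].
split=> //=; split=> //; have [_ lt] := rhoP _ Sx.
have [mono _] := rank_r (SL _ Sx).
by apply: leq_trans lt (mono _ _ _ ltx); rewrite le_max le1.
Qed.

(** Half an alternation: the ladders of [S] advance while those of [T] stand still. For [T],
    monotonicity squeezes [r x e'] between the equal values [r x e] and [r x z]. *)
Lemma alternation_step (S T : set K) e :
  S `<=` limits -> T `<=` limits -> delta e ->
  constant_beyond S e -> constant_beyond T e ->
  exists e', [/\ delta e', e < e',
    constant_beyond (S `&` [set x | (r x e < r x e')%N]) e' &
    constant_beyond (T `&` [set x | r x e = r x e']) e'].
Proof.
move=> SL TL de cS cT.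
have statS : stat S by apply: stationary_sub (cS e de (lexx e)) => x [].
have [e1 [de1 ee1 st1]] := stationary_jump statS SL de.
have [|e2 [de2 e12 c2]] := exists_constant_beyond st1 _ de1.
  by move=> x [/SL].
have ee2 := lt_le_trans ee1 e12.
exists e2; split=> // z dz e2z.
- apply: stationary_sub (stationary_tail (c2 _ dz e2z) de2) => x.
  move=> [[[Sx [/= _ lt]] eqx] e2x]; split=> //; split=> //=.
  have [mono _] := rank_r (SL _ Sx); exact: leq_trans lt (mono _ _ e12 e2x).
- have ez : e <= z by apply: le_trans e2z; exact: ltW.
  apply: stationary_sub (stationary_tail (cT _ dz ez) dz) => x [[Tx /= eqx] zx].
  have [mono _] := rank_r (TL _ Tx).
  have eq2 : r x e = r x e2.
    by apply/eqP; rewrite eqn_leq mono ?(ltW ee2) ?(le_lt_trans e2z)//= eqx mono.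
  by split; [split | rewrite /= -eq2].
Qed.

(* A fixed bound [N] works for all [z] at once because countably many
   counterexamples [z] would be bounded in [delta]. *)
Lemma constant_beyond_bounded (T : set K) e :
  T `<=` limits -> delta e -> constant_beyond T e ->
  exists N, constant_beyond (T `&` [set x | (r x e <= N)%N]) e.
Proof.
move=> TL de cT; apply: contrapT => no.
have /choice[z zP] N : exists z, [/\ delta z, e <= z &
    ~ stat (T `&` [set x | (r x e <= N)%N] `&` [set x | r x e = r x z])].
  apply: contrapT => no'; apply: no; exists N => z dz ez.
  by apply: contrapT => nst; apply: no'; exists z.
have [|g [dg zg _]] := @seq_sup z; first by move=> N; case: (zP N).
have eg : e <= g by apply/ltW/(le_lt_trans _ (zg 0%N)); case: (zP 0%N).
have [|N st] := stationary_bigcup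
    (Phi := fun N => [set x | (r x e <= N)%N]) (stationary_tail (cT _ dg eg) dg).
  by move=> x _; exists (r x e) => /=.
have [_ ez] := zP N; apply.
apply: stationary_sub st => x [[[Tx /= eqx] gx] leN]; split=> //=.
have [mono _] := rank_r (TL _ Tx).
apply/eqP; rewrite eqn_leq mono//= ?(lt_trans (zg N))//.
by rewrite eqx mono// ltW.
Qed.

(** * Counting the alternations of two ladders *)

Definition splits (a b : K) (v : nat) : bool :=
  `[< exists x y, [/\ x < a, y < a, r b x = v, r b y = v & r a x <> r a y] >].

Definition changes (a b : K) (m : nat) : nat := count (splits a b) (iota 0 m).

(** The block where [r b] equals [r b e0] contains [e0] and [e1], so it is split. Blocks of larger
    value below [r b e2] lie, below [a], between [e1] and [e2], where [r a] is constant. *)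
Lemma changes_step a b e0 e1 e2 :
  is_rank (r a) a -> is_rank (r b) b ->
  e0 < e1 -> e1 < e2 -> e2 < a -> a < b ->
  (r a e0 < r a e1)%N -> r b e0 = r b e1 ->
  r a e1 = r a e2 -> (r b e1 < r b e2)%N ->
  changes a b (r b e2) = (changes a b (r b e0)).+1.
Proof.
move=> [monoa _] [monob _] e01 e12 e2a ab lta eqb eqa ltb.
have e1a := lt_trans e12 e2a.
(* The range of values is cut into those below [r b e0], the value [r b e0] itself, and the larger
   ones. *)
rewrite /changes -(subnKC ltb) addSnnS -eqb iotaD count_cat add0n /= -[RHS]addn1.
congr addn; rewrite (_ : splits _ _ _ = true); last first.
  apply/asboolP; exists e0, e1; split=> //; first exact: lt_trans e1a.
  by move=> E; rewrite E ltnn in lta.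
rewrite (eq_in_count (a2 := pred0)) ?count_pred0// => v.
rewrite mem_iota eqb subnKC// => /andP[lo hi]; apply/asboolP => -[x [y [xa ya xv yv]]]; apply.
have const z : z < a -> r b z = v -> r a z = r a e2.
  move=> za zv; have zb := lt_trans za ab.
  have e1z : e1 <= z.
    rewrite leNgt; apply/negP => ze1.
    by move: lo; rewrite -zv ltnNge monob ?(ltW ze1)// (lt_trans e1a).
  have ze2 : z <= e2.
    rewrite leNgt; apply/negP => e2z.
    by move: hi; rewrite -zv ltnNge monob ?(ltW e2z).
  by apply/eqP; rewrite eqn_leq monoa//= -eqa monoa.
by rewrite (const x)// (const y).
Qed.

(** At most [N] changes occur below [r b e0], and each round adds exactly one. *)
Lemma alternations (S T : set K) e0 N k :
  S `<=` limits -> T `<=` limits -> delta e0 ->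
  constant_beyond S e0 -> constant_beyond T e0 ->
  (forall b, T b -> (r b e0 <= N)%N) ->
  exists S' T' e, [/\ S' `<=` S /\ T' `<=` T, delta e,
    constant_beyond S' e, constant_beyond T' e &
    forall a b, S' a -> T' b -> e < a -> a < b ->
      (k <= changes a b (r b e) <= k + N)%N].
Proof.
move=> SL TL de0 cS cT leN; elim: k => [|k [S1 [T1 [e [[SS1 TT1] de cS1 cT1 IH]]]]].
  exists S, T, e0; split=> // [|a b _ Tb _ _]; first by split.
  rewrite add0n /=.
  by apply: leq_trans (leN _ Tb); rewrite -{2}(size_iota 0 (r b e0)) count_size.
have S1L := subset_trans SS1 SL; have T1L := subset_trans TT1 TL.
have [e1 [de1 ee1 cS2 cT2]] := alternation_step S1L T1L de cS1 cT1.
(* The second half of the round, with the roles of the two sets exchanged. *)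
have [||e2 [de2 e12 cT3 cS3]] := alternation_step _ _ de1 cT2 cS2.
- by move=> x [/T1L].
- by move=> x [/S1L].
eexists _, _, e2; split; [split|exact: de2|exact: cS3|exact: cT3|].
- by move=> x [[/SS1]].
- by move=> x [[/TT1]].
move=> a b [[Sa /= lta] /= eqa] [[Tb /= eqb] /= ltb] e2a ab.
rewrite (@changes_step a b e e1 e2)//.
- have := IH a b Sa Tb (lt_trans (lt_trans ee1 e12) e2a) ab; lia.
- exact: rank_r (S1L _ Sa).
- exact: rank_r (T1L _ Tb).
Qed.

Lemma changes_attained (S T : set K) :
  stat S -> stat T -> S `<=` limits -> T `<=` limits ->
  exists N, forall k, exists a b, [/\ S a, T b, a < b &
    (k <= changes a b (r b a) <= k + N)%N].
Proof.
move=> statS statT SL TL.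
have [x [[_ dx] _]] := statS _ limits_club.
have [e [de _ cS]] := exists_constant_beyond statS SL dx.
have [e' [de' ee' cT]] := exists_constant_beyond statT TL de.
have [N cTN] := constant_beyond_bounded TL de' cT.
exists N => k; have cS' : constant_beyond S e'.
  move=> z dz e'z; have ez := le_trans ee' e'z.
  apply: stationary_sub (stationary_tail (cS _ dz ez) dz) => y [[Sy /= eqy] zy].
  split=> //=; have [mono _] := rank_r (SL _ Sy).
  by apply/eqP; rewrite eqn_leq mono//= -eqy mono// (le_lt_trans e'z).
have [|b [] //|S1 [T1 [e1 [[SS1 TT1] de1 cS1 cT1 H]]]] :=
    @alternations _ (T `&` [set x | (r x e' <= N)%N]) e' N k SL _ de' cS' cTN.
  by move=> y [/TL].
(* With [a] fixed, [b] is taken above [a] with [r b e1 = r b a], so that the count at [a] is the one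
   controlled at [e1]. *)
have [a [Sa _] e1a] := stationary_gt (cS1 _ de1 (lexx e1)) de1.
have [da _] := SL _ (SS1 _ Sa).
have [b [Tb /= eqb] ab] := stationary_gt (cT1 _ da (ltW e1a)) da.
exists a, b; split=> //; [exact: SS1 | by have [] := TT1 _ Tb |].
by rewrite -eqb; exact: H.
Qed.

End Ladders.
End StationarySets.

(** * Existence of ranks *)

(** [rho y] is the least code [f z] of a point [z] of [X] with [y <= z < x]. Raising [y] leaves
    fewer candidates, and only finitely many points have code at most [n]. *)
Lemma is_rank_exists d (K : orderType d) (X : set K) (x : K) :
  countable (X `&` [set y | y < x]) -> limit_point X x ->
  exists rho : K -> nat, is_rank rho x.
Proof.
move=> /countable_injP[f injf] [[x0 x0x] Xx].
have /choice[rho rhoP] y : exists n, y < x ->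
    (exists z, [/\ X z, y <= z, z < x & f z = n]) /\
    forall z, X z -> y <= z -> z < x -> (n <= f z)%N.
  have [yx|nyx] := pselect (y < x); last by exists 0%N => /nyx.
  have ex : exists n, `[< exists z, [/\ X z, y <= z, z < x & f z = n] >].
    have [z [Xz yz zx]] := Xx _ yx.
    by exists (f z); apply/asboolP; exists z; split=> //; exact: ltW.
  exists (ex_minn ex) => _; case: ex_minnP => n /asboolP exn minn.
  by split=> // z Xz yz zx; apply: minn; apply/asboolP; exists z.
exists rho; split.
  move=> y z yz zx; have [[w [Xw zw wx fw]] _] := rhoP z zx.
  have [_ lo] := rhoP y (le_lt_trans yz zx).
  by rewrite -fw; apply: lo => //; exact: le_trans zw.
suff H n : exists2 y, y < x & forall z, X z -> z < x -> (f z <= n)%N -> z < y.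
  move=> n; have [y yx Hy] := H n; exists y => //.
  have [[z [Xz yz zx <-]] _] := rhoP y yx.
  by rewrite ltnNge; apply/negP => /(Hy z Xz zx); rewrite ltNge yz.
have step (y : K) m : y < x -> exists y', [/\ y <= y', y' < x &
    forall z, X z -> z < x -> f z = m -> z < y'].
  move=> yx; have [[w [Xw wx fw]]|no] :=
      pselect (exists w, [/\ X w, w < x & f w = m]); last first.
    by exists y; split=> // z Xz zx fz; case: no; exists z.
  have [|w' [_ ww w'x]] := Xx (Order.max y w); first by rewrite gt_max yx.
  move: ww; rewrite gt_max => /andP[yw' ww'].
  exists w'; split=> //; first exact: ltW.
  by move=> z Xz zx fz; rewrite (injf z w) ?inE// fz fw.
elim: n => [|n [y yx IH]].
  have [y [_ yx Hy]] := step x0 0%N x0x; exists y => // z Xz zx.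
  by rewrite leqn0 => /eqP; exact: Hy.
have [y' [yy' y'x Hy]] := step y n.+1 yx; exists y' => // z Xz zx.
rewrite leq_eqVlt => /orP[/eqP /Hy ->//|/(IH _ Xz zx) zy].
exact: lt_le_trans yy'.
Qed.

(** * Suprema of sets of order type omega_1 *)

(** Otherwise the segments up to the points of [X] would cover [W] by countably many countable
    sets. *)
Lemma omega1_unbounded d (W : orderType d) (X : set W) :
  is_omega1 W -> countable X -> exists w, forall x, X x -> x < w.
Proof.
move=> [_ ncW cW] cX; apply: contrapT => no; apply: ncW.
have cU : countable (\bigcup_(x in X) ([set y | y < x] `|` [set x])).
  apply: bigcup_countable => // x _; rewrite -bigcup2E.
  apply: bigcup_countable => // -[|[|n]] _ //=; exact: countable1.
apply: sub_countable cU; apply: subset_card_le => w _.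
apply: contrapT => nw; apply: no; exists w => x Xx; rewrite ltNge le_eqVlt.
by apply/negP => /orP[/eqP wx|wx]; apply: nw; exists x => //; [right|left].
Qed.

Section OrdSup.
Context {d : Order.disp_t} {K : orderType d}.
Variable A : set K.
Hypothesis otA : has_order_type_omega1 A.

Lemma ord_sup_cofinality :
  [/\ uncountable_cofinality (ord_sup A), A `<=` ord_sup A &
      forall x, ord_sup A x -> countable (A `&` [set a | a < x])].
Proof.
have [d' [W [omW [f [mf rf]]]]] := otA.
have ltf : {mono f : x y / x < y} := leW_mono mf.
have nomax (w : W) : exists w', w < w'.
  by have [w' ww'] := omega1_unbounded omW (countable1 w); exists w'; exact: ww'.
split.
- split; first by move=> x y [a Aa /= xa] yx; exists a => //=; exact: lt_trans xa.
  move=> X cX XA.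
  have /choice[h hP] x : exists w, X x -> x < f w.
    have [Xx|nXx] := pselect (X x).
      by have [a + /=] := XA _ Xx; rewrite -rf => -[w _ <-]; exists w.
    have [w _] := omega1_unbounded omW (countable0 W); by exists w.
  have [|w hw] := @omega1_unbounded _ W (h @` X) omW.
    exact: sub_countable (card_image_le _ _) cX.
  have [w' ww'] := nomax w; exists (f w).
    by exists (f w') => /=; rewrite ?ltf// -rf; exists w'.
  by move=> x Xx; apply: lt_trans (hP _ Xx) _; rewrite ltf; apply: hw; exists x.
- rewrite -rf => _ [w _ <-]; have [w' ww'] := nomax w.
  by exists (f w') => /=; rewrite ?ltf//; exists w'.
- move=> x [a + /= xa]; rewrite -rf => -[w _ fw].
  have [_ _ cW] := omW; have := cW w.
  apply: sub_countable; apply: card_le_trans (card_image_le f _).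
  apply: subset_card_le => _ [[v _ <-] /= vx]; exists v => //=.
  by rewrite -ltf fw; exact: lt_trans xa.
Qed.

End OrdSup.

(** * The coloring *)

(* Each color is taken on arbitrarily long intervals, so that errors up to a
   fixed bound in the number of changes do not matter. *)
Definition color (n : nat) : nat := logn 2 (trunc_log 2 n).

Lemma color_long_intervals m N :
  exists k, forall n, (k <= n <= k + N)%N -> color n = m.
Proof.
(* The odd cofactor gives [logn 2 q = m], and its size gives [N < q], so that [2 ^ q + N] stays
   below [2 ^ q.+1]. *)
pose q := (2 ^ m * N.*2.+1)%N.
have Nq : (N < 2 ^ q)%N.
  apply: leq_trans (ltn_expl q (isT : (1 < 2)%N)).
  have : (0 < 2 ^ m)%N by rewrite expn_gt0.
  rewrite /q; nia.
exists (2 ^ q)%N => n nin; rewrite /color (@trunc_log_eq _ q)//; last first.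
  by rewrite expnS; lia.
by rewrite /q mulnC logn_Gauss ?pfactorK// coprime2n /= odd_double.
Qed.

Theorem theorem1p1 (d : Order.disp_t) (K : orderType d)
    (HK : is_uncountable_cardinal K) :
  exists c : pairs K -> nat,
    forall A B : set K,
      has_order_type_omega1 A -> has_order_type_omega1 B ->
      ord_sup A = ord_sup B ->
      stationary_in A (ord_sup A) -> stationary_in B (ord_sup B) ->
      c @` tensor A B = [set: nat].
Proof.
have [[woK _] _] := HK.
(* Ranks are fixed before [A] and [B] are given; zero is the default where none exists. *)
have /choice[r rP] (x : K) : exists rho : K -> nat,
    (exists rho, is_rank rho x) -> is_rank rho x.
  have [[rho ?]|no] := pselect (exists rho : K -> nat, is_rank rho x).
    by exists rho.
  by exists (fun=> 0%N) => /no.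
exists (fun p => color (changes r (sval p).1 (sval p).2 (r (sval p).2 (sval p).1))).
move=> A B otA _ <- statA statB; apply/seteqP; split=> // m _.
have [cofA subA cntA] := ord_sup_cofinality otA.
have cofinalA x : ord_sup A x -> exists2 a, A a & x < a by [].
have rank_r x : limits (ord_sup A) A x -> is_rank (r x) x.
  by move=> [dx lx]; apply: rP; apply: is_rank_exists lx; exact: cntA.
have clubL := limits_club woK cofA subA cofinalA.
(* Both sets are cut down to limit points of [A], which have ranks because [A] has only countably
   many points below each of them. *)
have [||N HN] := changes_attained woK cofA subA cofinalA cntA rank_r
   (stationary_club woK cofA statA clubL) (stationary_club woK cofA statB clubL).
- by move=> x [].
- by move=> x [].
have [k Hk] := color_long_intervals m N.
have [a [b [[Aa _] [Bb _] ab chg]]] := HN k.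
by exists (exist _ (a, b) ab) => //=; exact: Hk.
Qed.
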